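(* There exists a universal constant $D>0$ (not depending on $n$ or $\theta$) such that the following holds. Let $(\theta_n)_{n\ge1}$ be a nondecreasing sequence of positive real numbers and write $\theta=\theta_n$. Consider the condition $$( * )\qquad \theta \left( \log\left(1+\frac{n}{\theta}\right) - 1 + \frac{\theta}{n+\theta} \right) + \frac{n}{2(\theta+n)} - 1 >0,$$ and let $$\gamma_3 = \frac{\theta\left\{ \frac{1}{3} - \frac{\theta}{n+\theta} + \frac{\theta^2}{(n+\theta)^2} - \frac{\theta^3}{3(n+\theta)^3} \right\} + 2}{ \left\{ \theta \left( \log\left(1+\frac{n}{\theta}\right) -1 + \frac{\theta}{n+\theta} \right) + \frac{n}{2(\theta+n)} - 1 \right\}^2 }.$$ (i) Assume that there exists $n_1$ such that, for all $n\ge n_1$, $( * )$ holds, ${\rm var}(K)\ge1$, and $$\theta\left\{ \log\left(1+\frac{n}{\theta}\right) -2 + \frac{3\theta}{n+\theta} - \frac{\theta^2}{(n+\theta)^2} \right\} -3 + \frac{n}{2(n+\theta)} > 0.$$ Then for all $n\ge n_1$, $$\| F_{n,\theta} - \Phi \|_\infty \geq \frac{\gamma_2}{D} - \gamma_3,\qquad \gamma_2 = \frac{\theta\left\{ \log\left(1+\frac{n}{\theta}\right) -2 + \frac{3\theta}{n+\theta} - \frac{\theta^2}{(n+\theta)^2} \right\} -3 + \frac{n}{2(n+\theta)} }{\left\{ \theta \left( \log\left(1+\frac{n}{\theta}\right) - 1 + \frac{\theta}{n+\theta} \right) + \frac{n}{\theta+n} \right\}^{3/2}}.$$ (ii) Assume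 that there exists $n_2$ such that, for all $n\ge n_2$, $( * )$ holds, ${\rm var}(K)\ge1$, and $$\theta\left\{ \log\left(1+\frac{n}{\theta}\right) -2 + \frac{3\theta}{n+\theta} - \frac{\theta^2}{(n+\theta)^2} \right\} + 2 + \frac{n}{n+\theta} < 0.$$ Then for all $n\ge n_2$, $$\| F_{n,\theta} - \Phi \|_\infty \geq \frac{\gamma_4}{D} - \gamma_3,\qquad \gamma_4 = \frac{- \left[ \theta\left\{ \log\left(1+\frac{n}{\theta}\right) -2 + \frac{3\theta}{n+\theta} - \frac{\theta^2}{(n+\theta)^2} \right\} + 2 + \frac{n}{n+\theta} \right] }{\left\{ \theta \left( \log\left(1+\frac{n}{\theta}\right) - 1 + \frac{\theta}{n+\theta} \right) + \frac{n}{\theta+n} \right\}^{3/2}}.$$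
   Context: For $\theta>0$ and a positive integer $n$, let $K=K_{n,\theta}$ be a random variable with ${\rm P}(K=x)=\bar{s}(n,x)\theta^x/(\theta)_n$ for $x=1,\ldots,n$, where $(\theta)_n=\theta(\theta+1)\cdots(\theta+n-1)$ and $\bar{s}(n,x)$ is the coefficient of $\theta^x$ in $(\theta)_n$ viewed as a polynomial in $\theta$. Let $\mu_0={\rm E}[K]=\theta\sum_{i=1}^n \frac{1}{\theta+i-1}$ and $\sigma_0^2={\rm var}(K)=\theta\sum_{i=1}^n\frac{i-1}{(\theta+i-1)^2}$. $F_{n,\theta}$ is the distribution function of $X_{n,\theta}=(K-\mu_0)/\sigma_0$, $\Phi$ is the standard normal distribution function, and $\|f\|_\infty=\sup_{x\in\mathbb{R}}|f(x)|$. The parameter $\theta$ may depend on $n$ and is assumed to be nondecreasing in $n$ (constant $\theta$ allowed). *)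

(* Defs.v *)
From HB Require Import structures.
From mathcomp Require Import all_boot all_order all_algebra.
From mathcomp Require Import all_classical all_reals all_analysis.
From mathcomp Require Import measurable_realfun.

Set Implicit Arguments.
Unset Strict Implicit.
Unset Printing Implicit Defensive.

Import Order.TTheory GRing.Theory Num.Theory.
Import numFieldNormedType.Exports.

Local Open Scope classical_set_scope.
Local Open Scope ring_scope.

Definition rising_poly (R : realType) (n : nat) : {poly R} :=
  \prod_(i < n) ('X + (i%:R)%:P).

(* Unsigned Stirling numbers of the first kind, as elements of [R]. *)
Definition sbar (R : realType) (n x : nat) : R := (rising_poly R n)`_x.

(* The masses sum to 1, so they determine the law of [K]. *)
Definition has_K_law (R : realType) (d : measure_display)
    (T : measurableType d) (P : probability T R) (n : nat) (theta : R)
    (K : {RV P >-> R}) : Prop :=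
  forall x : nat, (1 <= x <= n)%N ->
    P [set w | K w = x%:R] =
      (sbar R n x * theta ^+ x / (rising_poly R n).[theta])%:E.

Definition standardize (R : realType) (d : measure_display)
    (T : measurableType d) (P : probability T R) (K : {RV P >-> R}) :
    {RV P >-> R} :=
  let mu0 := fine ('E_P[K])%E in
  let sigma0 := Num.sqrt (fine (variance P K)) in
  (K \- cst mu0) \* cst sigma0^-1.

Definition Fdist (R : realType) (d : measure_display)
    (T : measurableType d) (P : probability T R) (K : {RV P >-> R}) (x : R) : R :=
  fine (cdf (standardize K) x).

Definition Phi (R : realType) (x : R) : R :=
  fine (normal_prob (0 : R) 1 `]-oo, x]).

Definition sup_norm (R : realType) (f : R -> R) : \bar R :=
  ereal_sup (range (fun x => `|f x|%:E)).

(* [\int_0^n theta x / (theta + x)^2 dx], the main term of [var K]. *)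
Definition mainA (R : realType) (n : nat) (theta : R) : R :=
  theta * (ln (1 + n%:R / theta) - 1 + theta / (n%:R + theta)).

(* [\int_0^n theta x (x - theta) / (theta + x)^3 dx], the main term of the
   third central moment of [K]. *)
Definition mainB (R : realType) (n : nat) (theta : R) : R :=
  theta * (ln (1 + n%:R / theta) - 2 + 3 * theta / (n%:R + theta)
           - theta ^+ 2 / (n%:R + theta) ^+ 2).

Definition var_lower (R : realType) (n : nat) (theta : R) : R :=
  mainA n theta + n%:R / (2 * (theta + n%:R)) - 1.

Definition var_upper (R : realType) (n : nat) (theta : R) : R :=
  mainA n theta + n%:R / (theta + n%:R).

Definition third_lower (R : realType) (n : nat) (theta : R) : R :=
  mainB n theta - 3 + n%:R / (2 * (n%:R + theta)).

Definition third_upper (R : realType) (n : nat) (theta : R) : R :=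
  mainB n theta + 2 + n%:R / (n%:R + theta).

Definition gamma2 (R : realType) (n : nat) (theta : R) : R :=
  third_lower n theta / var_upper n theta `^ (3 / 2).

Definition gamma3 (R : realType) (n : nat) (theta : R) : R :=
  (theta * (1 / 3 - theta / (n%:R + theta)
            + theta ^+ 2 / (n%:R + theta) ^+ 2
            - theta ^+ 3 / (3 * (n%:R + theta) ^+ 3)) + 2)
  / var_lower n theta ^+ 2.

Definition gamma4 (R : realType) (n : nat) (theta : R) : R :=
  - third_upper n theta / var_upper n theta `^ (3 / 2).

(* Main.v *)
(** Let [W] be the standardized sum of independent Bernoulli variables with
    success probabilities [theta / (theta + i)], which has the law of the
    standardized [K]. For [h x = 1 / (1 + (e * x) ^ 2)] put
    [g x = h' x - x * h x]. A leave-one-out Taylor expansion gives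
    [E g(W) = - b / 2 * E h''(W) + O(e ^ 3 / var K)] where [b] is the third
    cumulant of [W], and [E h''(W)] is close to [-2 e ^ 2] because [W] has
    variance 1. On the other hand [g] has Gaussian mean 0 and bounded variation,
    so [|E g(W)|] is at most a constant times [||F - Phi||]. Finally [1 / var K]
    is at most a constant times [|b| + gamma3], so for a small fixed [e] the error
    term is absorbed, up to a multiple of [gamma3]. *)

Require Import Defs.
From mathcomp Require Import all_boot all_order all_algebra.
From mathcomp Require Import all_classical all_reals all_analysis.
From mathcomp Require Import measurable_realfun ring lra.
Import Order.TTheory GRing.Theory Num.Theory.
Import numFieldNormedType.Exports.
Local Open Scope classical_set_scope.
Local Open Scope ring_scope.

(** * Sums of independent Bernoulli variables *)

(* [bernE p n f] is the expectation of [f] at the sum of [n] independent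
   Bernoulli variables with success probabilities [p 0, ..., p n.-1]. *)
Fixpoint bernE {R : realType} (p : nat -> R) (n : nat) (f : nat -> R) : R :=
  if n is m.+1 then
    (1 - p m) * bernE p m f + p m * bernE p m (fun k => f k.+1)
  else f 0%N.

(* [bernL p n f] is the sum over [i < n] of [p i * (1 - p i)] times the
   expectation of [f k.+1 - f k] at the sum [k] of all variables but the
   [i]th. *)
Fixpoint bernL {R : realType} (p : nat -> R) (n : nat) (f : nat -> R) : R :=
  if n is m.+1 then
    p m * (1 - p m) * bernE p m (fun k => f k.+1 - f k)
    + ((1 - p m) * bernL p m f + p m * bernL p m (fun k => f k.+1))
  else 0.

Lemma bernE_lin {R : realType} (p : nat -> R) n (a b : R) f g :
  bernE p n (fun k => a * f k + b * g k) = a * bernE p n f + b * bernE p n g.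
Proof.
elim: n f g => [//|n IH] f g /=.
by rewrite IH (IH (fun k => f k.+1) (fun k => g k.+1)); ring.
Qed.

Lemma eq_bernE {R : realType} (p : nat -> R) n {f g} :
  f =1 g -> bernE p n f = bernE p n g.
Proof.
elim: n f g => [|n IH] f g fg /=; first exact: fg.
by rewrite (IH _ _ fg) (IH (fun k => f k.+1) (fun k => g k.+1)).
Qed.

Lemma bernE_cst {R : realType} (p : nat -> R) n (c : R) :
  bernE p n (fun=> c) = c.
Proof. by elim: n => [//|n IH] /=; rewrite !IH; ring. Qed.

Lemma bernE_le {R : realType} (p : nat -> R) n f g :
  (forall i, 0 <= p i <= 1) -> (forall k, f k <= g k) ->
  bernE p n f <= bernE p n g.
Proof.
move=> p01; elim: n f g => [|n IH] f g fg /=; first exact: fg.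
have /andP[p0 p1] := p01 n.
by rewrite lerD// ler_wpM2l ?subr_ge0// IH.
Qed.

Lemma bernE_norm_le {R : realType} (p : nat -> R) n f (c : R) :
  (forall i, 0 <= p i <= 1) -> (forall k, `|f k| <= c) -> `|bernE p n f| <= c.
Proof.
move=> p01 fc; rewrite ler_norml -[X in X <= _ <= _](bernE_cst p n).
rewrite -{2}(bernE_cst p n c); apply/andP; split; apply: bernE_le => // k;
  by have := fc k; rewrite ler_norml => /andP[].
Qed.

Definition bern_var {R : realType} (p : nat -> R) (n : nat) : R :=
  \sum_(i < n) p i * (1 - p i).

Definition bern_third {R : realType} (p : nat -> R) (n : nat) : R :=
  \sum_(i < n) p i * (1 - p i) * (1 - 2 * p i).

Lemma bernE_mean {R : realType} (p : nat -> R) n :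
  bernE p n (fun k => k%:R) = \sum_(i < n) p i.
Proof.
elim: n => [|n IH] /=; first by rewrite big_ord0.
rewrite big_ord_recr/= -IH [X in _ + _ * X](eq_bernE _ _ (g := fun k => 1 * k%:R + 1 * 1)).
  by rewrite (bernE_lin _ _ _ _ (fun k => k%:R) (fun=> 1)) bernE_cst; ring.
by move=> k; rewrite !mul1r natr1.
Qed.

(** Given all variables but the $i$th, with sum $m$, E[(X_i - p_i) f(m + X_i)] equals p_i (1 - p_i)
    (f(m + 1) - f(m)); summing over $i$ produces [bernL]. The induction peels off the last variable.
    This turns the factor x in the Stein operator into a finite difference. *)
Lemma bernE_center {R : realType} (p : nat -> R) n f :
  bernE p n (fun k => (k%:R - \sum_(i < n) p i) * f k) = bernL p n f.
Proof.
elim: n f => [|n IH] f /=; first by rewrite big_ord0; ring.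
rewrite big_ord_recr/= -!IH; set mu := \sum_(i < n) p i.
rewrite (eq_bernE _ _
  (g := fun k => 1 * ((k%:R - mu) * f k) + (- p n) * f k)); last first.
  by move=> k; ring.
rewrite [X in _ + _ * X](eq_bernE _ _
  (g := fun k => 1 * ((k%:R - mu) * f k.+1) + (1 - p n) * f k.+1)); last first.
  by move=> k; rewrite -natr1; ring.
rewrite [X in _ * X + _ = _]bernE_lin (bernE_lin _ _ _ _ _ (fun k => f k.+1)).
rewrite [X in _ = _ * X + _](eq_bernE _ _
  (g := fun k => 1 * f k.+1 + (-1) * f k)); last by move=> k; ring.
by rewrite (bernE_lin _ _ _ _ (fun k => f k.+1)); ring.
Qed.

Lemma bernL_id {R : realType} (p : nat -> R) n (c : R) :
  bernL p n (fun k => k%:R - c) = bern_var p n.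
Proof.
elim: n c => [|n IH] c /=; first by rewrite /bern_var big_ord0.
rewrite (eq_bernE _ _ (g := fun=> 1)); last by move=> k; rewrite -natr1; ring.
have -> : bernL p n (fun k => k.+1%:R - c) = bernL p n (fun k => k%:R - (c - 1)).
  by congr (bernL _ _ _); apply/funext => k; rewrite -natr1; ring.
by rewrite bernE_cst !IH /bern_var big_ord_recr/=; ring.
Qed.

Lemma bernE_variance {R : realType} (p : nat -> R) n :
  bernE p n (fun k => (k%:R - \sum_(i < n) p i) ^+ 2) = bern_var p n.
Proof. by rewrite -(bernL_id p n (\sum_(i < n) p i)) -bernE_center. Qed.

(* [f], [f1], [f2] stand for a function and its first two derivatives along an
   arithmetic progression of step [d]. Averaging [f1] over the omitted variable
   turns it into a value at the full sum, whence the factor [1 - 2 * p i]. *)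
Lemma bernL_taylor {R : realType} (p : nat -> R) n (f f1 f2 : nat -> R) (d M : R) :
  (forall i, 0 <= p i <= 1) -> 0 <= d -> 0 <= M ->
  (forall k, `|f k.+1 - f k - d * f1 k - d ^+ 2 / 2 * f2 k| <= M * d ^+ 3) ->
  (forall k, `|f1 k.+1 - f1 k - d * f2 k| <= M * d ^+ 2) ->
  (forall k, `|f2 k.+1 - f2 k| <= M * d) ->
  `|bernL p n f - d * bern_var p n * bernE p n f1
    - d ^+ 2 / 2 * bern_third p n * bernE p n f2|
    <= 3 * M * bern_var p n * d ^+ 3.
Proof.
move=> p01 d0 M0; elim: n f f1 f2 => [|n IH] f f1 f2 hf hf1 hf2.
  by rewrite /= /bern_var /bern_third !big_ord0 !(mulr0, mul0r, subr0) normr0.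
have /andP[p0 p1] := p01 n.
rewrite /bern_var /bern_third !big_ord_recr/= -/(bern_var p n) -/(bern_third p n).
set q := 1 - p n.
have q0 : 0 <= q by rewrite subr_ge0.
set V := bern_var p n; set B := bern_third p n.
have IH1 := IH _ _ _ hf hf1 hf2.
have IH2 := IH _ _ _ (fun k => hf k.+1) (fun k => hf1 k.+1) (fun k => hf2 k.+1).
rewrite -/V -/B in IH1 IH2.
set Q1 := (X in `|X| <= _) in IH1; set Q2 := (X in `|X| <= _) in IH2.
(* The multiples of the second and third remainders are chosen so that [f1] and [f2] enter only
   through their averages over the last variable. Each of the three terms is at most [M * d ^+ 3],
   whence the factor 3. *)
pose r k := (f k.+1 - f k - d * f1 k - d ^+ 2 / 2 * f2 k)
  - p n * d * (f1 k.+1 - f1 k - d * f2 k)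
  - d ^+ 2 / 2 * (1 - 2 * p n) * p n * (f2 k.+1 - f2 k).
have rE : forall k, r k = 1 * (f k.+1 - f k) + (- d) *
   (q * f1 k + p n * f1 k.+1) + (- (d ^+ 2 / 2 * (1 - 2 * p n))) *
   (q * f2 k + p n * f2 k.+1).
  by move=> k; rewrite /r /q; field.
have Er : bernE p n r = bernE p n (fun k => f k.+1 - f k)
   - d * (q * bernE p n f1 + p n * bernE p n (fun k => f1 k.+1))
   - d ^+ 2 / 2 * (1 - 2 * p n) *
     (q * bernE p n f2 + p n * bernE p n (fun k => f2 k.+1)).
  rewrite (eq_bernE _ _ (g := fun k => 1 * (1 * (f k.+1 - f k) + (- d) *
   (q * f1 k + p n * f1 k.+1)) + (- (d ^+ 2 / 2 * (1 - 2 * p n))) *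
   (q * f2 k + p n * f2 k.+1))); last by move=> k; rewrite rE; ring.
  rewrite (bernE_lin _ _ _ _ (fun k => 1 * (f k.+1 - f k) + (- d) *
    (q * f1 k + p n * f1 k.+1)) (fun k => q * f2 k + p n * f2 k.+1)).
  rewrite (bernE_lin _ _ _ _ (fun k => f k.+1 - f k)).
  rewrite (bernE_lin _ _ _ _ f1) (bernE_lin _ _ _ _ f2).
  by ring.
have rle : `|bernE p n r| <= 3 * M * d ^+ 3.
  apply: bernE_norm_le => // k; rewrite /r.
  have h1 : `|p n * d * (f1 k.+1 - f1 k - d * f2 k)| <= M * d ^+ 3.
    rewrite normrM (ger0_norm (mulr_ge0 p0 d0)).
    have -> : M * d ^+ 3 = (1 * d) * (M * d ^+ 2) by ring.
    by apply: ler_pM; rewrite ?mulr_ge0// ler_wpM2r.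
  have h2 : `|d ^+ 2 / 2 * (1 - 2 * p n) * p n * (f2 k.+1 - f2 k)| <= M * d ^+ 3.
    have hp : `|1 - 2 * p n| <= 1 by rewrite ler_norml; apply/andP; split; lra.
    have d2 := sqr_ge0 d.
    have -> : M * d ^+ 3 = (d ^+ 2 * 1 * 1) * (M * d) by ring.
    rewrite normrM; apply: ler_pM => //.
    rewrite normrM (ger0_norm p0); apply: ler_pM => //.
    rewrite normrM ger0_norm ?divr_ge0//; apply: ler_pM => //.
      by rewrite divr_ge0.
    by lra.
  have := hf k; rewrite !ler_norml in h1 h2 *.
  by move=> /andP[? ?]; move: h1 h2 => /andP[? ?] /andP[? ?]; apply/andP; split; lra.
set X := (X in `|X| <= _).
have -> : X = q * Q1 + p n * Q2 + p n * q * bernE p n r.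
  by rewrite Er /X /Q1 /Q2; ring.
have h1 : `|q * Q1| <= q * (3 * M * V * d ^+ 3).
  by rewrite normrM ger0_norm// ler_wpM2l.
have h2 : `|p n * Q2| <= p n * (3 * M * V * d ^+ 3).
  by rewrite normrM ger0_norm// ler_wpM2l.
have h3 : `|p n * q * bernE p n r| <= p n * q * (3 * M * d ^+ 3).
  by rewrite normrM ger0_norm ?mulr_ge0// ler_wpM2l// mulr_ge0.
apply: le_trans (ler_normD _ _) _.
apply: le_trans (lerD (ler_normD _ _) (lexx _)) _.
apply: le_trans (lerD (lerD h1 h2) h3) _.
by rewrite le_eqVlt; apply/orP; left; apply/eqP; rewrite /q; ring.
Qed.

(** * The Stirling masses as the law of a Bernoulli sum *)

Definition ewens_prob {R : realType} (theta : R) (i : nat) : R :=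
  theta / (theta + i%:R).

Definition ewens_mass {R : realType} (theta : R) (n k : nat) : R :=
  sbar R n k * theta ^+ k / (rising_poly R n).[theta].

Lemma ewens_prob_itv {R : realType} (theta : R) i :
  0 < theta -> 0 <= ewens_prob theta i <= 1.
Proof.
move=> t0; have i0 : 0 <= i%:R :> R by [].
rewrite /ewens_prob divr_ge0 ?ler_pdivrMr; lra.
Qed.

Lemma horner_rising_gt0 {R : realType} (theta : R) n :
  0 < theta -> 0 < (rising_poly R n).[theta].
Proof.
move=> t0; rewrite /rising_poly horner_prod; apply: prodr_gt0 => i _.
by rewrite !hornerE ltr_wpDr.
Qed.

Lemma rising_polyS (R : realType) n :
  rising_poly R n.+1 = rising_poly R n * ('X + (n%:R)%:P).
Proof. by rewrite /rising_poly big_ord_recr. Qed.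

Lemma sbar_gt (R : realType) n k : (n < k)%N -> sbar R n k = 0.
Proof.
elim: n k => [|n IH] k nk; rewrite /sbar.
  by rewrite /rising_poly big_ord0 coef1; case: k nk.
rewrite rising_polyS mulrDr coefD coefMX coefMC.
case: k nk => [//|k nk] /=.
by rewrite -!/(sbar R n _) !IH ?mul0r ?addr0// ltnW.
Qed.

Lemma sbar0 (R : realType) n : (0 < n)%N -> sbar R n 0 = 0.
Proof.
elim: n => [//|n IH] _; rewrite /sbar rising_polyS mulrDr coefD coefMX coefMC/=.
by case: n IH => [|n] IH; rewrite ?mulr0 ?add0r// -/(sbar R _ _) IH ?mul0r.
Qed.

(** Multiplying the rising polynomial by X + n and dividing its value by theta + n turns the
    Stirling recurrence into mixing with weights n / (theta + n) and theta / (theta + n), which is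
    the recursion defining [bernE]. *)
Lemma bernE_ewens {R : realType} (theta : R) n f : 0 < theta ->
  bernE (ewens_prob theta) n f = \sum_(k < n.+1) ewens_mass theta n k * f k.
Proof.
move=> t0; elim: n f => [|n IH] f.
  rewrite big_ord1 /ewens_mass /sbar /rising_poly big_ord0 coef1 /=.
  by rewrite -[X in X.[_]]polyC1 hornerC; field.
rewrite /= !IH [RHS]big_ord_recl /=.
set rn := (rising_poly R n).[theta].
have rn0 : rn != 0 by rewrite gt_eqF ?horner_rising_gt0.
have tn0 : theta + n%:R != 0 by rewrite gt_eqF// ltr_wpDr.
have rS : (rising_poly R n.+1).[theta] = rn * (theta + n%:R).
  by rewrite rising_polyS !hornerE.
have m0 : ewens_mass theta n.+1 0 = (1 - ewens_prob theta n) * ewens_mass theta n 0.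
  rewrite /ewens_mass /ewens_prob rS /sbar rising_polyS mulrDr coefD coefMX coefMC/=.
  by rewrite -/rn; field; rewrite rn0.
have mS k : ewens_mass theta n.+1 k.+1 = (1 - ewens_prob theta n) *
    ewens_mass theta n k.+1 + ewens_prob theta n * ewens_mass theta n k.
  rewrite /ewens_mass /ewens_prob rS /sbar rising_polyS mulrDr coefD coefMX coefMC/=.
  by rewrite -/rn exprS; field; rewrite rn0.
have -> : \sum_(i < n.+1) ewens_mass theta n.+1 (bump 0 i) * f (bump 0 i) =
  (1 - ewens_prob theta n) * \sum_(i < n.+1) ewens_mass theta n i.+1 * f i.+1
  + ewens_prob theta n * \sum_(i < n.+1) ewens_mass theta n i * f i.+1.
  rewrite !mulr_sumr -big_split/=; apply: eq_bigr => i _.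
  by rewrite /bump/= add1n mS; ring.
have -> : \sum_(i < n.+1) ewens_mass theta n i.+1 * f i.+1 =
    \sum_(i < n) ewens_mass theta n i.+1 * f i.+1.
  by rewrite big_ord_recr/= {2}/ewens_mass sbar_gt// !mul0r addr0.
rewrite m0 big_ord_recl/=.
by under [X in _ * (_ + X)]eq_bigr do rewrite /bump/= add1n; ring.
Qed.

(** * Variance and third cumulant *)

(** Both bounds are ln (1 + x) <= x, taken at x = 1 / y and at x = - 1 / (y + 1). *)
Lemma ln_incr_bounds {R : realType} (y : R) : 0 < y ->
  (y + 1)^-1 <= ln (y + 1) - ln y <= y^-1.
Proof.
move=> y0; have y1 : 0 < y + 1 by rewrite addr_gt0.
have yi : 0 < y^-1 by rewrite invr_gt0.
have yi1 : (y + 1)^-1 < 1 by rewrite invf_lt1// ltrDr.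
have E1 : ln (y + 1) - ln y = ln (1 + y^-1).
  by rewrite -ln_div ?posrE//; congr ln; field; rewrite gt_eqF.
have E2 : ln y - ln (y + 1) = ln (1 + - (y + 1)^-1).
  by rewrite -ln_div ?posrE//; congr ln; field; rewrite gt_eqF.
have := @le_ln1Dx R y^-1; have := @le_ln1Dx R (- (y + 1)^-1).
by rewrite -E1 -E2 => h1 h2; apply/andP; split; [have := h1 _ | have := h2 _]; lra.
Qed.

Lemma ewens_prob_step {R : realType} (theta : R) i : 0 < theta ->
  let p := ewens_prob theta i in let p' := ewens_prob theta i.+1 in
  [/\ 0 < p', p' <= p, p <= 1, theta * (p - p') = p * p' &
      p' <= theta * (ln (theta + i.+1%:R) - ln (theta + i%:R)) <= p].
Proof.
move=> t0 p p'; have y0 : 0 < theta + i%:R by rewrite ltr_wpDr.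
have yS : theta + i.+1%:R = theta + i%:R + 1 by rewrite -natr1 addrA.
have y1 : 0 < theta + i%:R + 1 by rewrite addr_gt0.
rewrite /p /p' /ewens_prob yS.
have i0 : 0 <= i%:R :> R by [].
split.
- by rewrite divr_gt0.
- by apply: ler_wpM2l; [exact: ltW | rewrite lef_pV2 ?posrE// lerDl].
- by rewrite ler_pdivrMr// mul1r lerDl.
- by field; rewrite !gt_eqF.
- by rewrite !ler_pM2l//; apply: ln_incr_bounds.
Qed.

(** In this form the increment in [n] is readable: with p, p' consecutive probabilities, theta (p -
    p') = p p', so [mainA] grows by the scaled logarithmic increment minus p p'. *)
Lemma mainA_sum {R : realType} (theta : R) n : 0 < theta ->
  mainA n theta = theta * (ln (theta + n%:R) - ln theta)
                  - theta * (1 - ewens_prob theta n).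
Proof.
move=> t0; have y0 : 0 < theta + n%:R by rewrite ltr_wpDr.
rewrite /mainA /ewens_prob (addrC n%:R) -ln_div ?posrE//.
have -> : 1 + n%:R / theta = (theta + n%:R) / theta by field; rewrite gt_eqF.
by ring.
Qed.

Lemma mainB_mainA {R : realType} (theta : R) n : 0 < theta ->
  mainB n theta = mainA n theta - theta * (1 - ewens_prob theta n) ^+ 2.
Proof.
move=> t0; have y0 : 0 < theta + n%:R by rewrite ltr_wpDr.
by rewrite /mainA /mainB /ewens_prob (addrC n%:R); field; rewrite gt_eqF.
Qed.

Lemma ewens_prob0 {R : realType} (theta : R) : 0 < theta -> ewens_prob theta 0 = 1.
Proof. by move=> t0; rewrite /ewens_prob addr0 divff ?gt_eqF. Qed.

(* Each summand is compared with an increment of the antiderivative; the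
   differences telescope because they are squeezed by increments of powers of
   [ewens_prob theta i]. *)
Lemma var_mainA {R : realType} (theta : R) n : 0 < theta ->
  let p := ewens_prob theta n in
  mainA n theta - (1 - p ^+ 2) <= bern_var (ewens_prob theta) n
    <= mainA n theta + (1 - p).
Proof.
move=> t0 /=; rewrite mainA_sum//; elim: n => [|n IH].
  by rewrite /bern_var big_ord0 ewens_prob0// addr0; apply/andP; split; lra.
rewrite /bern_var big_ord_recr/= -/(bern_var _ n).
have [] := ewens_prob_step theta n t0; move: IH.
set p := ewens_prob theta n; set p' := ewens_prob theta n.+1.
move=> /andP[h1 h2] p'0 p'p p1 tp /andP[l1 l2].
have c1 : p' ^+ 2 <= p * p' by nra.
have c2 : p * p' <= p ^+ 2 by nra.
by apply/andP; split; lra.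
Qed.

(** The increment of [mainB] is the scaled logarithmic increment minus 3 p p' plus p p' (p + p'), to
    be compared with the summand p - 3 p^2 + 2 p^3. The bounds [c1] to [c4] trade mixed products for
    pure powers, so that the errors telescope. *)
Lemma third_mainB {R : realType} (theta : R) n : 0 < theta ->
  let p := ewens_prob theta n in
  mainB n theta - 3 * (1 - p ^+ 2) + (1 - p ^+ 3)
    <= bern_third (ewens_prob theta) n
    <= mainB n theta + (1 - p) - 3 / 2 * (1 - p ^+ 2) + 2 * (1 - p ^+ 3).
Proof.
move=> t0 /=; rewrite mainB_mainA// mainA_sum//; elim: n => [|n IH].
  by rewrite /bern_third big_ord0 ewens_prob0// addr0; apply/andP; split; lra.
rewrite /bern_third big_ord_recr/= -/(bern_third _ n).
have [] := ewens_prob_step theta n t0; move: IH.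
set p := ewens_prob theta n; set p' := ewens_prob theta n.+1.
move=> /andP[h1 h2] p'0 p'p p1 tp /andP[l1 l2].
have tp2 : theta * (p ^+ 2 - p' ^+ 2) = p * p' * (p + p').
  by rewrite -tp; ring.
have c1 : p' ^+ 2 <= p * p' by nra.
have c2 : p * p' <= (p ^+ 2 + p' ^+ 2) / 2 by nra.
have c3 : p * p' * (p + p') <= p ^+ 3 + p' ^+ 3.
  have : 0 <= (p + p') * (p - p') ^+ 2 by rewrite mulr_ge0 ?sqr_ge0//; lra.
  by lra.
have c4 : 2 * p' ^+ 3 <= p * p' * (p + p').
  have : 0 <= p' * (p - p') * (p + 2 * p').
    by apply: mulr_ge0; [apply: mulr_ge0|]; lra.
  by lra.
by apply/andP; split; lra.
Qed.

(** The constant must be below 1: it makes [mainA] at most 10/11 of theta (1 - v)^2, hence [mainB]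
    at most - [mainA] / 10. The bound - ln v <= 1 / v - 1 is too weak for this, so it is applied to
    the square root of [v]. *)
Lemma Nln_le_sqr {R : realType} (v : R) : 4 / 5 <= v -> v <= 1 ->
  - ln v - (1 - v) <= 10 / 11 * (1 - v) ^+ 2.
Proof.
move=> v45 v1; have v0 : 0 < v by lra.
set w := Num.sqrt v; have w0 : 0 < w by rewrite sqrtr_gt0.
have wv : w ^+ 2 = v by rewrite sqr_sqrtr// ltW.
have w1 : w <= 1 by nra.
(* After replacing w^2 by its lower bound 4/5, the final inequality 2 + w <= 10/11 w (1 + w)^2
   becomes exactly w >= 6/7. *)
have w67 : 6 / 7 <= w. by nra.
have lnw : - ln w <= w^-1 - 1.
  have := @le_ln1Dx R (w^-1 - 1); rewrite [1 + _]addrC subrK lnV ?posrE//; apply.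
  have wi : 0 < w^-1 by rewrite invr_gt0.
  by lra.
have -> : ln v = 2 * ln w by rewrite -wv lnXn ?posrE// mulr_natl.
suff : 2 * (w^-1 - 1) - (1 - v) <= 10 / 11 * (1 - v) ^+ 2 by lra.
rewrite -(ler_pM2l w0) -wv.
have -> : w * (2 * (w^-1 - 1) - (1 - w ^+ 2)) = (1 - w) ^+ 2 * (2 + w).
  by field; rewrite gt_eqF.
have -> : w * (10 / 11 * (1 - w ^+ 2) ^+ 2)
    = (1 - w) ^+ 2 * (10 / 11 * w * (1 + w) ^+ 2) by ring.
by apply: ler_wpM2l; [exact: sqr_ge0 | nra].
Qed.

(** The integral of theta^2 x^2 / (theta + x)^4 over [0, n], the continuous analogue of the sum of
    (p_i (1 - p_i))^2. Expanding the cube gives the bracket in the numerator of [gamma3]. *)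
Definition mainC {R : realType} (n : nat) (theta : R) : R :=
  theta * (1 - ewens_prob theta n) ^+ 3 / 3.

(* When [n / theta] is bounded away from 0, [mainA - mainB] is at most [15 mainC];
   otherwise [mainB] is negative and of the order of [- mainA]. *)
Lemma mainA_le {R : realType} (theta : R) n : 0 < theta ->
  mainA n theta <= 10 * `|mainB n theta| + 15 * mainC n theta.
Proof.
move=> t0; have /andP[v0 v1] := ewens_prob_itv theta n t0.
have B1 := mainB_mainA theta n t0; have A1 := mainA_sum theta n t0.
have y0 : 0 < theta + n%:R by rewrite ltr_wpDr.
have lnv : ln (theta + n%:R) - ln theta = - ln (ewens_prob theta n).
  by rewrite /ewens_prob ln_div ?posrE// opprB.
rewrite /mainC; move: B1 A1 v0 v1 lnv; set v := ewens_prob theta n.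
set A := mainA n theta; set B := mainB n theta.
move=> B1 A1 v0 v1 lnv; have Babs := ler_norm B; have BabsN := ler_norm (- B).
rewrite normrN in BabsN; have B0 := normr_ge0 B.
have [v45|v45] := leP v (4 / 5).
  have : theta * (1 - v) ^+ 2 * (1 / 5) <= theta * (1 - v) ^+ 2 * (1 - v).
    by rewrite ler_wpM2l ?mulr_ge0 ?sqr_ge0 ?(ltW t0)//; lra.
  by lra.
have := ler_wpM2l (ltW t0) (Nln_le_sqr _ (ltW v45) v1).
have C0 : 0 <= theta * (1 - v) ^+ 3.
  by rewrite mulr_ge0 ?(ltW t0)// exprn_ge0//; lra.
rewrite lnv in A1.
by lra.
Qed.

Lemma powR_three_halves {R : realType} (x : R) : 0 <= x ->
  x `^ (3 / 2) = Num.sqrt x ^+ 3.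
Proof.
move=> x0; rewrite -powR12_sqrt// -[RHS]powR_mulrn ?powR_ge0// -powRrM.
by congr (_ `^ _); rewrite mulrC.
Qed.

Lemma gamma3E {R : realType} (theta : R) n : 0 < theta ->
  gamma3 n theta = (mainC n theta + 2) / var_lower n theta ^+ 2.
Proof.
move=> t0; have y0 : 0 < theta + n%:R by rewrite ltr_wpDr.
rewrite /gamma3 /mainC /ewens_prob (addrC n%:R); congr ((_ + _) / _).
by field; rewrite gt_eqF.
Qed.

(** Expresses the size [S^-1] of the Stein error and the ratio to be bounded through the normalized
    third cumulant, which is what the Stein expansion controls, up to [gamma3]. *)
Lemma main_terms_bounds {R : realType} (theta : R) n :
  let S := bern_var (ewens_prob theta) n in
  let b := `|bern_third (ewens_prob theta) n| in
  0 < theta -> 0 < var_lower n theta -> 1 <= S -> `|mainB n theta| <= 5 * b ->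
  S^-1 <= 150 * (b / Num.sqrt S ^+ 3) + 180 * gamma3 n theta /\
  `|mainB n theta| / var_upper n theta `^ (3 / 2)
    <= 30 * (b / Num.sqrt S ^+ 3).
Proof.
move=> S b t0 vl S1 Bb.
have y0 : 0 < theta + n%:R by rewrite ltr_wpDr.
have vE : n%:R / (theta + n%:R) = 1 - ewens_prob theta n.
  by rewrite /ewens_prob; field; rewrite gt_eqF.
have /andP[v0 v1] := ewens_prob_itv theta n t0.
have /andP[] := var_mainA theta n t0; have Ale := mainA_le theta n t0.
have C0 : 0 <= mainC n theta.
  by rewrite /mainC divr_ge0// mulr_ge0 ?(ltW t0)// exprn_ge0// subr_ge0.
have vuE : var_upper n theta = mainA n theta + (1 - ewens_prob theta n).
  by rewrite /var_upper vE.
have vlE : var_lower n theta = mainA n theta + (1 - ewens_prob theta n) / 2 - 1.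
  by rewrite /var_lower -vE; congr (_ + _ - _); field; rewrite gt_eqF.
rewrite gamma3E//.
move: vl vuE vlE Ale v0 v1 C0 Bb; rewrite -/S.
set v := ewens_prob theta n; set A := mainA n theta; set B := `|mainB n theta|.
set U := var_upper n theta; set L := var_lower n theta; set C := mainC n theta.
move=> L0 UE LE Ale v0 v1 C0 Bb h1 h2.
have v2 : 0 <= v ^+ 2 by exact: sqr_ge0.
(* Positivity of [L] forces A > 1 - (1 - v) / 2. *)
have A2 : 1 / 2 <= A by lra.
have b0 : 0 <= b by exact: normr_ge0.
have B0 : 0 <= B by exact: normr_ge0.
set r := Num.sqrt S.
have S0 : 0 < S by lra.
have r2 : r ^+ 2 = S by rewrite sqr_sqrtr// ltW.
have r1 : 1 <= r by rewrite -sqrtr1; exact: ler_wsqrtr.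
have r0 : 0 < r by lra.
have r3 : 0 < r ^+ 3 by rewrite exprn_gt0.
split.
  have LA : L ^+ 2 <= 4 * S ^+ 2 by nra.
  have L2 : 0 < L ^+ 2 by rewrite exprn_gt0.
  have c1 : b / r ^+ 4 <= b / r ^+ 3.
    by rewrite ler_wpM2l// lef_pV2 ?posrE ?exprn_gt0// (exprS r 3) ler_peMl// ltW.
  have c2 : (C + 2) / (4 * S ^+ 2) <= (C + 2) / L ^+ 2.
    rewrite ler_wpM2l//; first by lra.
    by rewrite lef_pV2 ?posrE// mulr_gt0// exprn_gt0.
  (* Here S <= A + 1 <= 3 A, while [Ale] and [Bb] give A <= 50 b + 15 C. *)
  have c3 : S^-1 <= (150 * b + 45 * C) / S ^+ 2.
    rewrite ler_pdivlMr ?exprn_gt0// expr2 mulrA mulVf ?gt_eqF// mul1r.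
    by lra.
  have E : (150 * b + 45 * C) / S ^+ 2
      = 150 * (b / r ^+ 4) + 180 * (C / (4 * S ^+ 2)).
    by rewrite -r2; field; rewrite gt_eqF.
  have c4 : C / (4 * S ^+ 2) <= (C + 2) / (4 * S ^+ 2).
    by rewrite ler_wpM2r ?invr_ge0 ?mulr_ge0 ?sqr_ge0//; lra.
  by lra.
have U0 : 0 < U by lra.
rewrite powR_three_halves ?(ltW U0)//.
set u := Num.sqrt U.
have u2 : u ^+ 2 = U by rewrite sqr_sqrtr// ltW.
have u0 : 0 < u by rewrite sqrtr_gt0.
have ru : r <= 2 * u. by nra.
have ru3 : r ^+ 3 <= 6 * u ^+ 3.
  have -> : 6 * u ^+ 3 = (3 * U) * (2 * u) by rewrite -u2; ring.
  by rewrite exprSr r2; apply: ler_pM; lra.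
rewrite mulrA ler_pdivlMr// mulrAC ler_pdivrMr ?exprn_gt0//.
apply: le_trans (ler_wpM2l B0 ru3) _.
rewrite mulrA; apply: ler_wpM2r; first by rewrite exprn_ge0// ltW.
by lra.
Qed.

(** The hypothesis forces [mainB] > 5/2, and the third cumulant is at least [mainB] - 2; the loss of
    2 is then at most 4/5 of [mainB]. *)
Lemma gamma2_le {R : realType} (theta : R) n : 0 < theta ->
  0 < third_lower n theta ->
  `|mainB n theta| <= 5 * `|bern_third (ewens_prob theta) n| /\
  gamma2 n theta <= `|mainB n theta| / var_upper n theta `^ (3 / 2).
Proof.
move=> t0 tl; have y0 : 0 < theta + n%:R by rewrite ltr_wpDr.
have /andP[v0 v1] := ewens_prob_itv theta n t0.
have /andP[h _] := third_mainB theta n t0.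
have vE : n%:R / (2 * (n%:R + theta)) = (1 - ewens_prob theta n) / 2.
  by rewrite /ewens_prob (addrC n%:R); field; rewrite gt_eqF.
move: tl; rewrite /gamma2 /third_lower vE => tl.
have v2 : 0 <= ewens_prob theta n ^+ 2 by exact: sqr_ge0.
have v3 : ewens_prob theta n ^+ 3 <= ewens_prob theta n ^+ 2.
  by rewrite exprSr ler_piMr.
split.
  have := ler_norm (bern_third (ewens_prob theta) n).
  by rewrite (ger0_norm (x := mainB _ _)); lra.
rewrite ler_wpM2r ?invr_ge0 ?powR_ge0//.
by apply: le_trans (ler_norm _); lra.
Qed.

(** The hypothesis forces [mainB] < -2, and the third cumulant is at most [mainB] + 3/2: the
    correction in [third_mainB] is 3/2 minus half of the product in [v3]. *)
Lemma gamma4_le {R : realType} (theta : R) n : 0 < theta ->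
  third_upper n theta < 0 ->
  `|mainB n theta| <= 5 * `|bern_third (ewens_prob theta) n| /\
  gamma4 n theta <= `|mainB n theta| / var_upper n theta `^ (3 / 2).
Proof.
move=> t0 tl; have y0 : 0 < theta + n%:R by rewrite ltr_wpDr.
have /andP[v0 v1] := ewens_prob_itv theta n t0.
have /andP[_ h] := third_mainB theta n t0.
have vE : n%:R / (n%:R + theta) = 1 - ewens_prob theta n.
  by rewrite /ewens_prob (addrC n%:R); field; rewrite gt_eqF.
move: tl; rewrite /gamma4 /third_upper vE => tl.
have v3 : 0 <= ewens_prob theta n * (4 * ewens_prob theta n ^+ 2
    - 3 * ewens_prob theta n + 2).
  rewrite mulr_ge0//.
  have : 0 <= (2 * ewens_prob theta n - 3 / 4) ^+ 2 by exact: sqr_ge0.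
  by lra.
split.
  have := ler_norm (- bern_third (ewens_prob theta) n); rewrite normrN.
  by rewrite (ler0_norm (x := mainB _ _)); lra.
rewrite ler_wpM2r ?invr_ge0 ?powR_ge0// -normrN.
by apply: le_trans (ler_norm _); lra.
Qed.

(** * Stein expansion *)

Lemma is_derive_add {R : realType} {f g : R -> R} {x df dg : R} :
  is_derive x 1 f df -> is_derive x 1 g dg ->
  is_derive x 1 (fun y => f y + g y) (df + dg).
Proof. exact: is_deriveD. Qed.

Lemma is_derive_mul {R : realType} {f g : R -> R} {x df dg : R} :
  is_derive x 1 f df -> is_derive x 1 g dg ->
  is_derive x 1 (fun y => f y * g y) (df * g x + f x * dg).
Proof.
by move=> hf hg; apply: is_derive_eq (is_deriveM hf hg) _; rewrite /GRing.scale/=; ring.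
Qed.

Lemma is_derive_scale {R : realType} (c : R) {f : R -> R} {x df : R} :
  is_derive x 1 f df -> is_derive x 1 (fun y => c * f y) (c * df).
Proof. exact: is_deriveZ. Qed.

Lemma is_derive_ident {R : realType} (x : R) : is_derive x 1 (fun y : R => y) 1.
Proof. exact: is_derive_id. Qed.

Lemma is_derive_const {R : realType} (c x : R) : is_derive x 1 (fun=> c) 0.
Proof. exact: is_derive_cst. Qed.

Lemma is_derive_congr {R : realType} {f g : R -> R} {x df dg : R} :
  is_derive x 1 f df -> f =1 g -> df = dg -> is_derive x 1 g dg.
Proof. by move=> + /funext <- <-. Qed.

Lemma mean_value {R : realType} {f df : R -> R} (a b : R) :
  (forall x : R, is_derive x 1 f (df x)) -> a <= b ->
  exists2 c, a <= c <= b & f b - f a = df c * (b - a).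
Proof.
move=> hf ab; have fc : {within `[a, b], continuous f}.
  by apply: derivable_within_continuous => x _; exact: ex_derive.
have [c cab E] := MVT_segment ab (fun x _ => hf x) fc.
by exists c => //; move: cab; rewrite in_itv.
Qed.

(** Each remainder is obtained from the one for the next derivative by the mean value theorem, so
    the factorials are lost. *)
Lemma taylor_crude {R : realType} (f f1 f2 f3 : R -> R) (M x t : R) :
  (forall x : R, is_derive x 1 f (f1 x)) -> (forall x : R, is_derive x 1 f1 (f2 x)) ->
  (forall x : R, is_derive x 1 f2 (f3 x)) -> (forall x : R, `|f3 x| <= M) -> 0 <= t ->
  [/\ `|f (x + t) - f x - t * f1 x - t ^+ 2 / 2 * f2 x| <= M * t ^+ 3,
      `|f1 (x + t) - f1 x - t * f2 x| <= M * t ^+ 2 &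
      `|f2 (x + t) - f2 x| <= M * t].
Proof.
move=> hf hf1 hf2 hM t0; have M0 : 0 <= M by apply: le_trans (hM 0).
have E s : x + s - x = s by ring.
have b2 s : 0 <= s -> `|f2 (x + s) - f2 x| <= M * s.
  move=> s0; have [|c _] := mean_value x (x + s) hf2; first by lra.
  by rewrite E => ->; rewrite normrM (ger0_norm s0) ler_wpM2r.
have b1 s : 0 <= s -> `|f1 (x + s) - f1 x - s * f2 x| <= M * s ^+ 2.
  move=> s0; have [|c /andP[c0 c1]] := mean_value x (x + s) hf1.
    by lra.
  rewrite E => ->; rewrite (mulrC s) -mulrBl normrM (ger0_norm s0) expr2 mulrA.
  apply: ler_wpM2r => //; have -> : c = x + (c - x) by ring.
  by apply: le_trans (b2 _ _) _; [lra | rewrite ler_wpM2l//; lra].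
split; [|exact: b1|exact: b2].
(* The derivative of [F] is the first-order remainder of [f1], already bounded by [b1]. *)
pose F y := f y + (- f1 x * y + (- (f2 x / 2)) * ((y - x) * (y - x))).
have hF (y : R) : is_derive y 1 F (f1 y - f1 x - (y - x) * f2 x).
  have dx : is_derive y 1 (fun y : R => y - x) 1.
    apply: (is_derive_congr (is_derive_add (is_derive_ident y) (is_derive_const (- x) y))) => //.
    by rewrite addr0.
  apply: (is_derive_congr (is_derive_add (hf y) (is_derive_add
    (is_derive_scale (- f1 x) (is_derive_ident y))
    (is_derive_scale (- (f2 x / 2)) (is_derive_mul dx dx))))) => //.
  by field.
have [|c /andP[c0 c1]] := mean_value x (x + t) hF; first by lra.
have -> : F (x + t) - F x = f (x + t) - f x - t * f1 x - t ^+ 2 / 2 * f2 x.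
  by rewrite /F; field.
rewrite E => ->; rewrite normrM (ger0_norm t0) exprSr mulrA.
apply: ler_wpM2r => //; have -> : c = x + (c - x) by ring.
rewrite E; apply: le_trans (b1 _ _) _; first by lra.
by apply: ler_wpM2l => //; nra.
Qed.

(** * The rational test function and its Stein expansion *)

(** A rational test function keeps all estimates polynomial. It is also the derivative of arctan,
    which serves to dominate the derivative of [stein_g]. *)
Definition phi0 {R : realType} (u : R) : R := (1 + u ^+ 2)^-1.

Definition phi1 {R : realType} (u : R) : R := - 2 * (u * phi0 u ^+ 2).

Definition phi2 {R : realType} (u : R) : R := (6 * u ^+ 2 - 2) * phi0 u ^+ 3.

Definition phi3 {R : realType} (u : R) : R :=
  24 * (u * (1 - u ^+ 2)) * phi0 u ^+ 4.

Lemma phi0_gt0 {R : realType} (u : R) : 0 < phi0 u.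
Proof. by rewrite invr_gt0 ltr_wpDr ?sqr_ge0. Qed.

Lemma phi0_inv {R : realType} (u : R) : (1 + u ^+ 2) * phi0 u = 1.
Proof. by rewrite /phi0 divff// gt_eqF// ltr_wpDr ?sqr_ge0. Qed.

Lemma phi0_le1 {R : realType} (u : R) : phi0 u <= 1.
Proof. by have := phi0_gt0 u; have := phi0_inv u; have := sqr_ge0 u; nra. Qed.

Lemma is_derive_phi0 {R : realType} (u : R) : is_derive u 1 phi0 (phi1 u).
Proof.
have d : is_derive u 1 (fun y : R => 1 + y * y) (u + u).
  apply: (is_derive_congr (is_derive_add (is_derive_const 1 u)
    (is_derive_mul (is_derive_ident u) (is_derive_ident u)))) => //; ring.
have nz : 1 + u * u != 0 by rewrite gt_eqF// ltr_wpDr// -expr2 sqr_ge0.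
apply: (is_derive_congr (is_deriveV (f := fun y : R => 1 + y * y) nz d)) => //.
rewrite /GRing.scale/= /phi1 /phi0 expr2; field; exact: nz.
Qed.

Lemma is_derive_phi0X {R : realType} (u : R) n :
  is_derive u 1 (fun y => phi0 y ^+ n.+1) (- 2 * n.+1%:R * u * phi0 u ^+ n.+2).
Proof.
apply: (is_derive_congr (is_deriveX n.+1 (is_derive_phi0 u))) => [y|].
  by rewrite exprfctE.
rewrite /= /GRing.scale/= /phi1 !exprSr; ring.
Qed.

Lemma is_derive_phi1 {R : realType} (u : R) : is_derive u 1 phi1 (phi2 u).
Proof.
apply: (is_derive_congr (is_derive_scale (- 2) (is_derive_mul (is_derive_ident u)
  (is_derive_phi0X u 1)))) => //.
have E := phi0_inv u; rewrite /phi2.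
(* A factor (1 + u^2) [phi0 u] = 1 is inserted to bring all terms to the same power of [phi0]. *)
transitivity (-2 * (phi0 u ^+ 2 * ((1 + u ^+ 2) * phi0 u) - 4 * u ^+ 2 * phi0 u ^+ 3)).
  by rewrite E; ring.
by ring.
Qed.

Lemma is_derive_phi2 {R : realType} (u : R) : is_derive u 1 phi2 (phi3 u).
Proof.
have d : is_derive u 1 (fun y : R => 6 * y ^+ 2 - 2) (12 * u).
  apply: (is_derive_congr (is_derive_add (is_derive_scale 6 (is_derive_mul
    (is_derive_ident u) (is_derive_ident u))) (is_derive_const (- 2) u))) => //.
  by ring.
apply: (is_derive_congr (is_derive_mul d (is_derive_phi0X u 2))) => //.
have E := phi0_inv u; rewrite /phi3.
transitivity (12 * u * phi0 u ^+ 3 * ((1 + u ^+ 2) * phi0 u)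
  - 6 * u * (6 * u ^+ 2 - 2) * phi0 u ^+ 4); first by rewrite E; ring.
by ring.
Qed.

Lemma phi3_le {R : realType} (u : R) : `|phi3 u| <= 12.
Proof.
have p0 := phi0_gt0 u; have p1 := phi0_le1 u; have E := phi0_inv u.
have h : `|u * (1 - u ^+ 2)| <= (1 + u ^+ 2) ^+ 2 / 2.
  by rewrite ler_norml; apply/andP; split; nra.
have q0 : 0 <= phi0 u ^+ 2 by exact: sqr_ge0.
have h1 : `|u * (1 - u ^+ 2)| * phi0 u ^+ 2 <= 1 / 2.
  apply: le_trans (ler_wpM2r q0 h) _.
  by rewrite mulrAC -exprMn E expr1n.
have h2 : phi0 u ^+ 2 <= 1 by rewrite expr_le1// ltW.
rewrite normrM normrM (ger0_norm (x := 24))// (ger0_norm (x := phi0 u ^+ 4)).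
  have := ler_pM _ q0 h1 h2; rewrite mulr_ge0//.
  by move=> /(_ isT); lra.
by rewrite exprn_ge0// ltW.
Qed.

Lemma phi1_norm_le {R : realType} (u : R) : `|u * phi1 u| <= 2 * phi0 u.
Proof.
have p0 := phi0_gt0 u; have E := phi0_inv u.
have -> : u * phi1 u = - 2 * (u ^+ 2 * phi0 u) * phi0 u by rewrite /phi1; ring.
have u2 := sqr_ge0 u; have -> : u ^+ 2 * phi0 u = 1 - phi0 u by lra.
have h : 0 <= 1 - phi0 u <= 1 by apply/andP; split; nra.
rewrite normrM (ger0_norm (ltW p0)) ler_wpM2r ?(ltW p0)// ler_norml.
by move: h => /andP[? ?]; apply/andP; split; lra.
Qed.

Lemma phi2_norm_le {R : realType} (u : R) : `|phi2 u| <= 8 * phi0 u.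
Proof.
have p0 := phi0_gt0 u; have p1 := phi0_le1 u; have E := phi0_inv u.
have u2 := sqr_ge0 u.
have -> : phi2 u = (6 * (u ^+ 2 * phi0 u) - 2 * phi0 u) * phi0 u * phi0 u.
  by rewrite /phi2; ring.
have -> : u ^+ 2 * phi0 u = 1 - phi0 u by lra.
rewrite normrM (ger0_norm (ltW p0)) ler_wpM2r ?(ltW p0)//.
rewrite normrM (ger0_norm (ltW p0)) -[8]mulr1.
by apply: ler_pM => //; [exact: ltW | rewrite ler_norml; apply/andP; split; lra].
Qed.

(** The right side is the tangent at t = 0 of [phi2] as a function of t = u^2: after clearing
    denominators only - 30 t^2 - 34 t^3 - 12 t^4 remains. A bound quadratic in u can be averaged
    knowing the variance alone. *)
Lemma phi2_le {R : realType} (u : R) : phi2 u <= - 2 + 12 * u ^+ 2.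
Proof.
have p0 := phi0_gt0 u; have E := phi0_inv u; have u2 := sqr_ge0 u.
set t := u ^+ 2 in u2 E *.
have -> : phi2 u = - 2 + 12 * t
    + (6 * t - 2 - (- 2 + 12 * t) * (1 + t) ^+ 3) * phi0 u ^+ 3.
  transitivity (- 2 + 12 * t + ((6 * t - 2) * phi0 u ^+ 3
    - (- 2 + 12 * t) * ((1 + t) * phi0 u) ^+ 3)); last by ring.
  by rewrite E /phi2 -/t; ring.
rewrite gerDl mulr_le0_ge0 ?exprn_ge0 ?(ltW p0)//.
have t2 := sqr_ge0 t; have t3 : 0 <= t ^+ 3 by rewrite exprn_ge0.
have t4 : 0 <= t ^+ 4 by rewrite exprn_ge0.
by lra.
Qed.

Definition stein_g {R : realType} (e x : R) : R :=
  e * phi1 (e * x) - x * phi0 (e * x).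

(** The condition 12 e^2 <= 1 keeps the mean of [phi2] below -1, so the cumulant term retains its
    order. The 36 is 3 times the bound 12 on [phi3]. *)
Lemma stein_bernE {R : realType} (p : nat -> R) n (e : R) :
  let S := bern_var p n in
  let w k := (k%:R - \sum_(i < n) p i) / Num.sqrt S in
  (forall i, 0 <= p i <= 1) -> 0 < S -> 0 < e -> 12 * e ^+ 2 <= 1 ->
  `|bern_third p n| / Num.sqrt S ^+ 3 * (e ^+ 2 / 2)
    <= `|bernE p n (fun k => stein_g e (w k))| + 36 * e ^+ 3 / S.
Proof.
move=> S w p01 S0 e0 e12; set s := Num.sqrt S in w *.
have s0 : 0 < s by rewrite sqrtr_gt0.
have s2 : s ^+ 2 = S by rewrite sqr_sqrtr// ltW.
pose u k := e * w k; pose d := e / s.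
have d0 : 0 <= d by rewrite divr_ge0// ltW.
have uS k : u k.+1 = u k + d.
  by rewrite /u /w /d -natr1; field; rewrite gt_eqF.
have M0 : 0 <= 12 :> R by [].
have taylor k := taylor_crude _ _ _ _ _ (u k) _ is_derive_phi0 is_derive_phi1
  is_derive_phi2 phi3_le d0.
have t0 k : `|(phi0 \o u) k.+1 - (phi0 \o u) k - d * (phi1 \o u) k
    - d ^+ 2 / 2 * (phi2 \o u) k| <= 12 * d ^+ 3.
  by have [+ _ _] := taylor k; rewrite -uS.
have t1 k : `|(phi1 \o u) k.+1 - (phi1 \o u) k - d * (phi2 \o u) k|
    <= 12 * d ^+ 2.
  by have [_ + _] := taylor k; rewrite -uS.
have t2 k : `|(phi2 \o u) k.+1 - (phi2 \o u) k| <= 12 * d.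
  by have [_ _] := taylor k; rewrite -uS.
have := bernL_taylor p n _ _ _ _ _ p01 d0 M0 t0 t1 t2.
rewrite -bernE_center -/S.
set L := bernE p n (fun k => _ * _); set E1 := bernE p n (phi1 \o u).
set E2 := bernE p n (phi2 \o u); set b := bern_third p n.
move=> main.
have gE : bernE p n (fun k => stein_g e (w k)) = e * E1 - s^-1 * L.
  rewrite (eq_bernE _ _ (g := fun k => e * (phi1 \o u) k
    + (- s^-1) * ((k%:R - \sum_(i < n) p i) * (phi0 \o u) k))); last first.
    by move=> k; rewrite /stein_g /u /w /=; field; rewrite gt_eqF.
  by rewrite bernE_lin mulNr.
(* Since [w] has variance 1, the mean of (e w)^2 is e^2. *)
have E2le : E2 <= -1.
  have : E2 <= bernE p n (fun k => 1 * -2 + (12 * e ^+ 2 / S) *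
      (k%:R - \sum_(i < n) p i) ^+ 2).
    apply: bernE_le => // k /=; apply: le_trans (phi2_le _) _.
    rewrite le_eqVlt; apply/orP; left; apply/eqP.
    by rewrite /u /w -s2; field; rewrite gt_eqF.
  rewrite (bernE_lin _ _ _ _ (fun=> -2)) bernE_cst bernE_variance -/S.
  by rewrite divfK ?gt_eqF//; lra.
set G := bernE p n (fun k => stein_g e (w k)) in gE *.
have mainG : `|- G - b / s ^+ 3 * (e ^+ 2 / 2) * E2| <= 36 * e ^+ 3 / S.
  have -> : - G - b / s ^+ 3 * (e ^+ 2 / 2) * E2
      = (L - d * S * E1 - d ^+ 2 / 2 * b * E2) / s.
    by rewrite gE /d -s2; field; rewrite gt_eqF.
  rewrite normrM (ger0_norm (x := s^-1)) ?invr_ge0 ?(ltW s0)//.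
  rewrite ler_pdivrMr//; apply: le_trans main _.
  rewrite le_eqVlt; apply/orP; left; apply/eqP.
  by rewrite /d -s2; field; rewrite gt_eqF.
have -> : `|b| / s ^+ 3 * (e ^+ 2 / 2) = `|b / s ^+ 3 * (e ^+ 2 / 2)|.
  rewrite normrM (ger0_norm (x := e ^+ 2 / 2)) ?divr_ge0 ?sqr_ge0//.
  by rewrite normrM (ger0_norm (x := (s ^+ 3)^-1))// invr_ge0 exprn_ge0// ltW.
set X := b / s ^+ 3 * (e ^+ 2 / 2) in mainG *.
have : `|X| <= `|X * E2|.
  by rewrite (normrM X E2) ler_peMr// ler0_norm; lra.
have : `|X * E2| <= `|- G| + `|- G - X * E2|.
  by have := ler_normB (- G) (- G - X * E2); rewrite [X in `|X| <= _]subKr.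
rewrite normrN; lra.
Qed.

(** * Comparison with the normal distribution function *)

Local Notation gauss := (normal_pdf 0 1).

Lemma gaussE {R : realType} (x : R) :
  gauss x = normal_peak (1 : R) * expR (- (x * x) / 2).
Proof.
by rewrite normal_pdfE ?oner_neq0// /normal_fun subr0 expr2 expr1n mulr2n.
Qed.

Lemma gauss_bounds {R : realType} (x : R) : 0 <= gauss x <= normal_peak (1 : R).
Proof. by rewrite normal_pdf_ge0 normal_pdf_ub// oner_neq0. Qed.

Lemma is_derive_gauss {R : realType} (x : R) :
  is_derive x 1 (gauss : R -> R) (- x * gauss x).
Proof.
have d : is_derive x 1 (fun y : R => - (1 / 2) * (y * y)) (- x).
  apply: (is_derive_congr (is_derive_scale (- (1 / 2))
    (is_derive_mul (is_derive_ident x) (is_derive_ident x)))) => //.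
  by field.
have dE := is_derive1_comp
  (g := fun y : R => - (1 / 2) * (y * y)) (is_derive_expR (- (1 / 2) * (x * x))) d.
apply: (is_derive_congr (is_derive_scale (normal_peak 1) dE)) => [y|] /=.
  by rewrite gaussE; congr (_ * expR _); field.
rewrite gaussE; have -> : - (x * x) / 2 = - (1 / 2) * (x * x) by field.
by ring.
Qed.

Lemma is_derive_Phi {R : realType} (x : R) : is_derive x 1 (@Phi R) (gauss x).
Proof.
have intg : lebesgue_measure.-integrable [set` Interval -oo%O (BRight (x + 1))]
    (EFin \o (gauss : R -> R)).
  by apply: integrableS (integrable_normal_pdf 0 1).
have x1 : x < x + 1 by rewrite ltrDl.
have cg : {for x, continuous (gauss : R -> R)}.
  by apply: continuous_normal_pdf; rewrite oner_neq0.
have [dF E] := continuous_FTC1 x1 intg (ltNyr x) cg.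
by apply: DeriveDef; [exact: dF | rewrite -E derive1E].
Qed.

Lemma Phi_itv {R : realType} (x : R) : 0 <= Phi x <= 1.
Proof.
have h0 : (0 <= normal_prob (0 : R) 1 `]-oo, x])%E by [].
have h1 : (normal_prob (0 : R) 1 `]-oo, x] <= 1)%E by exact: probability_le1.
rewrite /Phi fine_ge0//=.
by rewrite -lee_fin fineK// ge0_fin_numE// (le_lt_trans h1)// ltry.
Qed.

(** * Smoothing: from a bound on distribution functions to one on [stein_g] *)

Definition stein_g' {R : realType} (e x : R) : R :=
  e * (e * phi2 (e * x)) - (phi0 (e * x) + x * (e * phi1 (e * x))).

Lemma is_derive_comp_scale {R : realType} {e x df : R} {f : R -> R} :
  is_derive (e * x) 1 f df -> is_derive x 1 (fun y : R => f (e * y)) (e * df).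
Proof.
move=> hf; apply: (is_derive_congr (is_derive1_comp (g := fun y : R => e * y) hf
  (is_derive_scale e (is_derive_ident x)))) => //.
by rewrite mulr1 mulrC.
Qed.

Lemma is_derive_stein_g {R : realType} (e x : R) :
  is_derive x 1 (stein_g e) (stein_g' e x).
Proof.
apply: (is_derive_congr (is_derive_add
  (is_derive_scale e (is_derive_comp_scale (is_derive_phi1 _)))
  (is_derive_scale (- 1) (is_derive_mul (is_derive_ident x)
    (is_derive_comp_scale (is_derive_phi0 _)))))) => [y|].
  by rewrite /stein_g; ring.
by rewrite /stein_g'; ring.
Qed.

(** The constant 4 is 1 + 1 + 2: the condition on [e] reduces the second-derivative term to one
    [phi0], and [phi1_norm_le] accounts for two. *)
Lemma stein_g'_norm_le {R : realType} (e x : R) : 8 * e ^+ 2 <= 1 ->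
  `|stein_g' e x| <= 4 * phi0 (e * x).
Proof.
move=> e8; have p0 := phi0_gt0 (e * x).
have := phi2_norm_le (e * x); have := phi1_norm_le (e * x).
have -> : stein_g' e x = e ^+ 2 * phi2 (e * x)
    - (phi0 (e * x) + e * x * phi1 (e * x)) by rewrite /stein_g'; ring.
have e2 := sqr_ge0 e.
rewrite !ler_norml => /andP[a1 a2] /andP[b1 b2].
have := ler_wpM2l e2 b1; have := ler_wpM2l e2 b2.
have : e ^+ 2 * (8 * phi0 (e * x)) <= phi0 (e * x).
  by rewrite mulrA (mulrC _ 8) ler_piMl// ltW.
by move=> *; apply/andP; split; lra.
Qed.

(* An antiderivative of [(c - Phi) * stein_g']: since [phi0 (e * x)] solves the
   Stein equation [h' x - x * h x = stein_g e x], the product [h * gauss] is an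
   antiderivative of [stein_g e * gauss]. *)
Definition stein_prim {R : realType} (e c x : R) : R :=
  (c - Phi x) * stein_g e x + phi0 (e * x) * gauss x.

Lemma is_derive_stein_prim {R : realType} (e c x : R) :
  is_derive x 1 (stein_prim e c) ((c - Phi x) * stein_g' e x).
Proof.
apply: (is_derive_congr (is_derive_add (is_derive_mul (is_derive_add
  (is_derive_const c x) (is_derive_scale (- 1) (is_derive_Phi x)))
  (is_derive_stein_g e x))
  (is_derive_mul (is_derive_comp_scale (is_derive_phi0 _))
    (is_derive_gauss x)))) => [y|].
  by rewrite /stein_prim mulN1r.
by rewrite /stein_g; ring.
Qed.

(** The derivative of [stein_prim] is at most 4 D phi0 (e x) in absolute value, the derivative of
    the arctan term, so that term minus s times [stein_prim] does not decrease for either sign s.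
    The interval is open at [b], where the distribution function may jump; the mean value point is
    interior. *)
Lemma stein_prim_incr {R : realType} (e c D a b : R) : 0 < e -> 8 * e ^+ 2 <= 1 ->
  a <= b -> (forall x, a <= x < b -> `|c - Phi x| <= D) ->
  `|stein_prim e c b - stein_prim e c a|
    <= D * (4 / e * atan (e * b) - 4 / e * atan (e * a)).
Proof.
move=> e0 e8; rewrite le_eqVlt => /predU1P[-> _|ab hD].
  by rewrite !subrr normr0 mulr0.
have D0 : 0 <= D by apply: le_trans (hD a _) => //; rewrite lexx.
have mono s : s = 1 \/ s = -1 -> s * (stein_prim e c b - stein_prim e c a)
    <= D * (4 / e * atan (e * b) - 4 / e * atan (e * a)).
  move=> hs.
  pose H y := D * (4 / e * atan (e * y)) + (- s) * stein_prim e c y.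
  have dH (x : R) : is_derive x 1 H
      (D * (4 * phi0 (e * x)) + (- s) * ((c - Phi x) * stein_g' e x)).
    apply: (is_derive_congr (is_derive_add (is_derive_scale D
      (is_derive_scale (4 / e) (is_derive_comp_scale
        (is_derive1_atan (e * x)))))
      (is_derive_scale (- s) (is_derive_stein_prim e c x)))) => //.
    by congr (_ * _ + _); rewrite mulrA divfK ?gt_eqF.
  have cH : {within `[a, b], continuous H}.
    by apply: derivable_within_continuous => x _; exact: ex_derive.
  have [x xab E] := MVT ab (fun x _ => dH x) cH.
  have : 0 <= H b - H a.
    rewrite E mulr_ge0 ?subr_ge0 ?(ltW ab)//.
    have : `|(c - Phi x) * stein_g' e x| <= D * (4 * phi0 (e * x)).
      rewrite normrM; apply: ler_pM => //; last exact: stein_g'_norm_le.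
      by apply: hD; move: xab; rewrite in_itv/= => /andP[/ltW -> ->].
    rewrite ler_norml => /andP[? ?].
    by case: hs => ->; lra.
  by rewrite /H; lra.
have := mono 1 (or_introl erefl); have := mono (-1) (or_intror erefl).
by move=> h1 h2; rewrite ler_norml; apply/andP; split; lra.
Qed.

(** Only |c - Phi| <= 1 is used: the decay comes from x^2 phi0 (e x) <= e^-2, not from a Gaussian
    tail estimate. *)
Lemma stein_prim_decay {R : realType} (e c x : R) : 0 < e -> c = 0 \/ c = 1 ->
  `|x| * `|stein_prim e c x| <= 2 + e^-2 + e^-1 * normal_peak (1 : R).
Proof.
move=> e0 hc; have p0 := phi0_gt0 (e * x); have p1 := phi0_le1 (e * x).
have E := phi0_inv (e * x).
have /andP[P0 P1] := Phi_itv x; have /andP[g0 g1] := gauss_bounds x.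
have hg : `|x| * `|stein_g e x| <= 2 + e^-2.
  rewrite -normrM.
  have -> : x * stein_g e x = e * x * phi1 (e * x)
      - e^-2 * ((e * x) ^+ 2 * phi0 (e * x)).
    by rewrite /stein_g; field; rewrite gt_eqF.
  have -> : (e * x) ^+ 2 * phi0 (e * x) = 1 - phi0 (e * x) by lra.
  have e2 : 0 < e^-2 by rewrite invr_gt0 exprn_gt0.
  apply: le_trans (ler_normB _ _) _; apply: lerD.
    by apply: le_trans (phi1_norm_le _) _; lra.
  by rewrite ger0_norm ?mulr_ge0 ?(ltW e2) ?subr_ge0// ler_piMr ?(ltW e2)//; lra.
have hx : `|x| * phi0 (e * x) <= e^-1.
  rewrite -(ler_pM2l e0) divff ?gt_eqF// mulrA -{1}(ger0_norm (ltW e0)) -normrM.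
  set u := e * x in p0 p1 E *.
  have : `|u| <= 1 + u ^+ 2.
    by rewrite ler_norml; have := sqr_ge0 (u - 1); have := sqr_ge0 (u + 1);
       move=> *; apply/andP; split; nra.
  by move=> /(ler_wpM2r (ltW p0)); rewrite E.
have hcP : `|c - Phi x| <= 1.
  by rewrite ler_norml; case: hc => ->; apply/andP; split; lra.
apply: le_trans (ler_wpM2l (normr_ge0 _) (ler_normD _ _)) _.
rewrite mulrDr; apply: lerD.
  rewrite normrM mulrCA; apply: le_trans hg.
  by rewrite ler_piMl// mulr_ge0.
rewrite normrM (ger0_norm (ltW p0)) (ger0_norm g0) mulrA.
by apply: ler_pM => //; rewrite mulr_ge0// ltW.
Qed.

(* Summation by parts against [stein_prim], whose constant jumps by [m k] at
   [w k]; no integral is needed because [stein_prim e 0] and [stein_prim e 1]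
   vanish at infinity. *)
Lemma stein_smoothing {R : realType} (w m : nat -> R) n (e D : R) :
  0 < e -> 8 * e ^+ 2 <= 1 -> (forall k, w k <= w k.+1) ->
  \sum_(k < n.+1) m k = 1 ->
  (forall (k : nat) (x : R), (k <= n.+1)%N -> ((0 < k)%N -> w k.-1 <= x) ->
     ((k <= n)%N -> x < w k) ->
     `|\sum_(j < k) m j - Phi x| <= D) ->
  `|\sum_(k < n.+1) m k * stein_g e (w k)| <= D * (4 / e * pi).
Proof.
move=> e0 e8 wS m1 hD; pose L x := 4 / e * atan (e * x).
have jump c c' x : stein_prim e (c + c') x = stein_prim e c x + c' * stein_g e x.
  by rewrite /stein_prim; ring.
have D0 : 0 <= D.
  by apply: le_trans (normr_ge0 _) (hD 0%N (w 0%N - 1) _ _ _) => // _; lra.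
have Lpi x y : L y - L x <= 4 / e * pi.
  rewrite /L -mulrBr ler_pM2l ?divr_gt0//.
  by have := atan_ltpi2 (e * y); have := atan_gtNpi2 (e * x); lra.
(* Telescoping from [xm] up to [w k]: each atom passed contributes its jump [m j * stein_g e (w j)],
   and atom [k] itself is not yet counted. *)
have step xm k : (k <= n)%N -> xm <= w 0%N ->
    `|stein_prim e (\sum_(j < k) m j) (w k)
      - \sum_(j < k) m j * stein_g e (w j) - stein_prim e 0 xm|
    <= D * (L (w k) - L xm).
  move=> + xw; elim: k => [_|k IH kn].
    rewrite !big_ord0 subr0; apply: stein_prim_incr => // x /andP[_ xlt].
    by have := hD 0%N x isT; rewrite big_ord0; apply.
  have kn' : (k <= n)%N by exact: ltnW.
  have h : `|stein_prim e (\sum_(j < k.+1) m j) (w k.+1)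
      - stein_prim e (\sum_(j < k.+1) m j) (w k)| <= D * (L (w k.+1) - L (w k)).
    apply: stein_prim_incr => // x /andP[xge xlt].
    by apply: hD => //; exact: leqW.
  have := lerD h (IH kn'); rewrite -mulrDr => /(le_trans (ler_normD _ _)).
  rewrite [X in stein_prim e X (w k)]big_ord_recr/= jump [X in _ -> `|_ - X - _| <= _]big_ord_recr/=.
  set a := stein_prim e _ (w k.+1); set b := stein_prim e _ (w k).
  set c := stein_prim e 0 xm; set t := \sum_(j < k) _; set u := m k * _.
  have -> : a - (b + u) + (b - t - c) = a - (t + u) - c by ring.
  by have -> : L (w k.+1) - L (w k) + (L (w k) - L xm) = L (w k.+1) - L xm by ring.
pose K := 2 + e^-2 + e^-1 * normal_peak (1 : R).
have K0 : 0 <= K.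
  by rewrite !addr_ge0 ?mulr_ge0 ?invr_ge0 ?exprn_ge0 ?normal_peak_ge0 ?(ltW e0).
have decay c eta x : 0 < eta -> c = 0 \/ c = 1 -> K / eta + 1 <= `|x| ->
    `|stein_prim e c x| <= eta.
  move=> eta0 hc xK; have := stein_prim_decay e c x e0 hc; rewrite -/K => h.
  have x0 : 0 < `|x| by apply: lt_le_trans xK; rewrite ltr_wpDl// divr_ge0// ltW.
  have : K / eta <= `|x| by lra.
  rewrite ler_pdivrMr// => h2.
  by rewrite -(ler_pM2l x0); apply: le_trans h h2.
apply/ler_addgt0Pr => eta eta0.
(* Beyond [z] in absolute value the primitive is at most eta / 2, so the two end values cost [eta]
   together. *)
pose z := K / (eta / 2) + 1.
have z0 : 0 < z by rewrite ltr_wpDl// divr_ge0// divr_ge0// ltW.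
pose xm := Num.min (w 0%N) (- z); pose xp := Num.max (w n) z.
have xmw : xm <= w 0%N by rewrite ge_min lexx.
have xpw : w n <= xp by rewrite le_max lexx.
have xmz : z <= `|xm|.
  have : xm <= - z by rewrite ge_min lexx orbT.
  by move=> h; rewrite ler0_norm; lra.
have xpz : z <= `|xp|.
  have : z <= xp by rewrite le_max lexx orbT.
  by move=> h; rewrite ger0_norm; lra.
have hm := decay 0 (eta / 2) xm _ (or_introl erefl) xmz.
have hp := decay 1 (eta / 2) xp _ (or_intror erefl) xpz.
have last : `|stein_prim e 1 xp - stein_prim e 1 (w n)| <= D * (L xp - L (w n)).
  apply: stein_prim_incr => // x /andP[xge _]; rewrite -m1.
  by apply: hD => //; rewrite ltnn.
have := lerD last (step xm n (leqnn n) xmw); rewrite -mulrDr.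
have -> : L xp - L (w n) + (L (w n) - L xm) = L xp - L xm by ring.
have := ler_wpM2l D0 (Lpi xm xp).
move: hm hp; rewrite divr_gt0// => /(_ isT) + /(_ isT).
have -> : stein_prim e 1 (w n)
    = stein_prim e (\sum_(j < n) m j) (w n) + m n * stein_g e (w n).
  by rewrite -m1 big_ord_recr/= jump.
set a := stein_prim e 1 xp; set c := stein_prim e 0 xm.
set b := stein_prim e _ (w n); set t := \sum_(j < n) _ * _.
rewrite [\sum_(k < n.+1) _]big_ord_recr/= -/t; set u := m n * _ => hm hp hL hh.
have -> : t + u = a - c - (a - (b + u) + (b - t - c)) by ring.
apply: le_trans (ler_normB _ _) _.
have := ler_normB a c; have := ler_normD (a - (b + u)) (b - t - c).
by lra.
Qed.

(** * The law of K *)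

Lemma ewens_mass_sum {R : realType} (theta : R) n :
  0 < theta -> \sum_(k < n.+1) ewens_mass theta n k = 1.
Proof.
move=> t0; rewrite -(bernE_cst (ewens_prob theta) n 1) bernE_ewens//.
by apply: eq_bigr => k _; rewrite mulr1.
Qed.

(** The masses prescribed at 1, ..., n already sum to 1, so almost surely [K] takes one of these
    values and [f \o K] is a finite combination of indicators. *)
Lemma expectation_K {R : realType} (d : measure_display) (T : measurableType d)
    (P : probability T R) n (theta : R) (K : {RV P >-> R}) (f : R -> R) :
  (0 < n)%N -> 0 < theta -> has_K_law n theta K -> measurable_fun setT f ->
  'E_P[f \o K]%E = (bernE (ewens_prob theta) n (fun k => f k%:R))%:E.
Proof.
move=> n0 t0 law mf.
pose A (i : 'I_n) : set T := K @^-1` [set i.+1%:R].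
have mA i : measurable (A i) by apply: measurable_funPTI.
have PA i : P (A i) = (ewens_mass theta n i.+1)%:E.
  by apply: law => /=; exact: ltn_ord.
have m0 : ewens_mass theta n 0 = 0 by rewrite /ewens_mass sbar0// !mul0r.
have inA i w : A i w -> K w = i.+1%:R by [].
have tA : trivIset setT A.
  move=> i j _ _ [w [/inA Ki /inA Kj]]; apply/val_inj/eqP.
  by rewrite -eqSS -(eqr_nat R) -Ki -Kj.
have PU : P (\big[setU/set0]_(i < n) A i) = 1%E.
  rewrite measure_bigsetU_ord// -(ewens_mass_sum theta n t0) big_ord_recl/=.
  by rewrite m0 add0r -sumEFin; apply: eq_bigr => i _; rewrite PA.
pose g (i : 'I_n) (w : T) : \bar R := ((f i.+1%:R)%:E * (\1_(A i) w)%:E)%E.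
have ig i : P.-integrable setT (g i).
  by apply: integrableZl => //; exact: integrable_indic.
have fK : measurable_fun setT (EFin \o (f \o K)).
  by apply/measurable_EFinP; exact: measurableT_comp.
rewrite unlock (@ae_eq_integral _ _ _ P setT (fun w => \sum_(i < n) g i w)%E)//.
- rewrite integral_sum//= bernE_ewens// big_ord_recl/= m0 mul0r add0r -sumEFin.
  apply: eq_bigr => i _; rewrite integralZl//; last exact: integrable_indic.
  rewrite integral_indic// setIT EFinM muleC; congr (_ * _)%E; exact: PA.
- by apply: emeasurable_sum => i; exact: measurable_int (ig i).
have mU : measurable (\big[setU/set0]_(i < n) A i).
  by apply: bigsetU_measurable => i _; exact: mA.
exists (~` \big[setU/set0]_(i < n) A i); split; first exact: measurableC.
  by apply: eq_trans (probability_setC P mU) _; rewrite PU subee.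
apply: subsetC => w; rewrite -bigcup_seq => -[i _ Aiw] _ /=.
rewrite (bigD1 i)//= big1 ?adde0.
  by rewrite /g indicE mem_set// mule1 /= (inA _ _ Aiw).
move=> j ji; rewrite /g indicE memNset ?mule0// => Ajw.
by move/eqP: ji; apply; apply: tA => //; exists w.
Qed.

Lemma expectation_K_id {R : realType} (d : measure_display) (T : measurableType d)
    (P : probability T R) n (theta : R) (K : {RV P >-> R}) :
  (0 < n)%N -> 0 < theta -> has_K_law n theta K ->
  'E_P[K]%E = (\sum_(i < n) ewens_prob theta i)%:E.
Proof.
move=> n0 t0 law; rewrite -bernE_mean.
by rewrite -(expectation_K _ _ _ _ _ _ _ n0 t0 law (@measurable_id _ _ _)).
Qed.

Lemma variance_K {R : realType} (d : measure_display) (T : measurableType d)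
    (P : probability T R) n (theta : R) (K : {RV P >-> R}) :
  (0 < n)%N -> 0 < theta -> has_K_law n theta K ->
  variance P K = (bern_var (ewens_prob theta) n)%:E.
Proof.
move=> n0 t0 law; rewrite /variance unlock.
rewrite (expectation_K_id _ _ _ _ _ _ n0 t0 law)/= -bernE_variance.
set mu := \sum_(i < n) _.
rewrite -(expectation_K _ _ _ _ _ _ (fun y => (y - mu) ^+ 2) n0 t0 law)//.
by apply: measurable_funX; exact: measurable_funB.
Qed.

Lemma Fdist_K {R : realType} (d : measure_display) (T : measurableType d)
    (P : probability T R) n (theta : R) (K : {RV P >-> R}) (x : R) :
  (0 < n)%N -> 0 < theta -> has_K_law n theta K ->
  let S := bern_var (ewens_prob theta) n in
  let mu := \sum_(i < n) ewens_prob theta i in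
  Fdist K x
    = \sum_(k < n.+1 | (k%:R - mu) / Num.sqrt S <= x) ewens_mass theta n k.
Proof.
move=> n0 t0 law S mu.
pose B := [set y : R | (y - mu) / Num.sqrt S <= x].
have mB : measurable B.
  have -> : B = (fun y => (y - mu) / Num.sqrt S) @^-1` `]-oo, x].
    by apply/seteqP; split => y; rewrite /B /= in_itv.
  rewrite -[X in measurable X]setTI.
  by apply: measurable_funM => //; exact: measurable_funB.
have FE : cdf (standardize K) x = 'E_P[\1_B \o K]%E.
  have -> : \1_B \o K = \1_(K @^-1` B) :> (T -> R).
    by apply/funext => w; rewrite /= !indicE.
  rewrite expectation_indic; last by apply: measurable_funPTI.
  rewrite /cdf /distribution /pushforward; congr (P _).
  apply/seteqP; split => w; rewrite /standardize /B /= in_itv/=;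
    by rewrite (expectation_K_id _ _ _ _ _ _ n0 t0 law) (variance_K _ _ _ _ _ _ n0 t0 law).
rewrite /Fdist FE (expectation_K _ _ _ _ _ _ _ n0 t0 law)/=; last first.
  exact: measurable_indic.
rewrite bernE_ewens// [RHS]big_mkcond/=; apply: eq_bigr => k _.
rewrite indicE; case: ifPn => h; first by rewrite mem_set ?mulr1.
by rewrite memNset ?mulr0//; exact/negP.
Qed.

(** * Choice of constants and conclusion *)

(** With this value 36 e^3 = e^2 / 600, so the bound 150 b + 180 [gamma3] on [S^-1] makes the error
    at most e^2 (b / 4 + 3/10 [gamma3]); the first part is half of the main term e^2 b / 2. *)
Definition stein_scale {R : realType} : R := 1 / 21600.

(** Absorbing the error gives b <= 4 (q / e^2) r + 6/5 [gamma3], with q the smoothing factor and r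
    the distance; multiplying by the 30 of [main_terms_bounds] yields 120 and 36. *)
Definition stein_const {R : realType} : R :=
  120 * (4 / stein_scale * pi) / stein_scale ^+ 2 + 36.

Lemma stein_const_ge36 {R : realType} : 36 <= stein_const :> R.
Proof.
have e0 : 0 < stein_scale :> R by rewrite /stein_scale; lra.
rewrite /stein_const lerDr divr_ge0 ?sqr_ge0// mulr_ge0// mulr_ge0 ?pi_ge0//.
by rewrite divr_ge0// ltW.
Qed.

(** To be read with [e] the square of [stein_scale], [r] a bound on the distance, [b] the normalized
    third cumulant, [v] the inverse variance and [c] the numerator of the claim. *)
Lemma absorb_error {R : realFieldType} {e q r b g v c D : R} :
  0 < e -> 0 <= r -> 0 <= g -> D = 120 * q / e + 36 -> 36 <= D ->
  b * (e / 2) <= r * q + e / 600 * v -> v <= 150 * b + 180 * g -> c <= 30 * b ->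
  c / D - g <= r.
Proof.
move=> e0 r0 g0 DE D36 hb hv hc.
have hve := ler_wpM2l (ltW e0) hv.
have bE : b <= 4 * (q / e * r) + 6 / 5 * g.
  rewrite -(ler_pM2l e0).
  have -> : e * (4 * (q / e * r) + 6 / 5 * g) = 4 * (q * r) + 6 / 5 * (e * g).
    by field; rewrite gt_eqF.
  by lra.
have D0 : 0 < D by lra.
rewrite lerBlDr ler_pdivrMr//.
have -> : (r + g) * D = 120 * (q / e * r) + 36 * r + g * D.
  by rewrite DE; field; rewrite gt_eqF.
have := ler_wpM2l g0 D36.
by lra.
Qed.

Lemma sup_norm_ge {R : realType} (f : R -> R) (c : R) :
  (forall r, (forall x, `|f x| <= r) -> c <= r) -> (c%:E <= sup_norm f)%E.
Proof.
move=> h; have ub x : (`|f x|%:E <= sup_norm f)%E.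
  by apply: ereal_sup_ubound; exists x.
case E : (sup_norm f) => [r||]; first 1 last.
- by rewrite leey.
- by have := ub 0; rewrite E leeNy_eq.
by rewrite lee_fin; apply: h => x; rewrite -lee_fin -E.
Qed.

Lemma ewens_smoothing {R : realType} (d : measure_display) (T : measurableType d)
    (P : probability T R) n (theta : R) (K : {RV P >-> R}) (e r : R) :
  let S := bern_var (ewens_prob theta) n in
  let mu := \sum_(i < n) ewens_prob theta i in
  (0 < n)%N -> 0 < theta -> has_K_law n theta K -> 0 < S ->
  0 < e -> 8 * e ^+ 2 <= 1 -> (forall x, `|Fdist K x - Phi x| <= r) ->
  `|bernE (ewens_prob theta) n (fun k => stein_g e ((k%:R - mu) / Num.sqrt S))|
    <= r * (4 / e * pi).
Proof.
move=> S mu n0 t0 law S0 e0 e8 hr; rewrite bernE_ewens//.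
pose w k : R := (k%:R - mu) / Num.sqrt S.
have w_mono : {mono w : i j / (i <= j)%N >-> i <= j}.
  move=> i j; rewrite /w ler_pM2r ?invr_gt0 ?sqrtr_gt0//.
  by rewrite lerD2r ler_nat.
apply: (stein_smoothing w) => // [k||k x kn wk xw].
- by rewrite w_mono.
- exact: ewens_mass_sum.
(* Between consecutive atoms [w k.-1] and [w k] the distribution function is the sum of the first
   [k] masses; k = 0 and k = n + 1 are the unbounded ends. *)
have <- : Fdist K x = \sum_(j < k) ewens_mass theta n j => //.
rewrite (Fdist_K _ _ _ _ _ _ x n0 t0 law) -/S -/mu.
rewrite (big_ord_widen _ _ kn); apply: eq_bigl => j; rewrite -/(w j).
apply/idP/idP => [wj|jk].
  have [kn'|nk] := leqP k n; last by apply: leq_trans (ltn_ord j) nk.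
  by rewrite ltnNge -w_mono -ltNge; apply: le_lt_trans wj (xw kn').
have k0 : (0 < k)%N by exact: leq_ltn_trans jk.
by apply: le_trans (wk k0); rewrite w_mono -ltnS prednK.
Qed.

(** Common core of both cases; the sign of the third cumulant enters only through the last two
    hypotheses. *)
Lemma sup_norm_lower {R : realType} (d : measure_display) (T : measurableType d)
    (P : probability T R) n (theta gamma : R) (K : {RV P >-> R}) :
  (0 < n)%N -> 0 < theta -> has_K_law n theta K ->
  0 < var_lower n theta -> (1 <= variance P K)%E ->
  `|mainB n theta| <= 5 * `|bern_third (ewens_prob theta) n| ->
  gamma <= `|mainB n theta| / var_upper n theta `^ (3 / 2) ->
  ((gamma / stein_const - gamma3 n theta)%R%:E
    <= sup_norm (fun x => (Fdist K x - Phi x)%R))%E.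
Proof.
move=> n0 t0 law vl; rewrite (variance_K _ _ _ _ _ _ n0 t0 law) lee_fin => S1 hB hg.
apply: sup_norm_ge => r hr.
have r0 : 0 <= r by apply: le_trans (hr 0).
have p01 i : 0 <= ewens_prob theta i <= 1 by exact: ewens_prob_itv.
have S0 : 0 < bern_var (ewens_prob theta) n by lra.
have [hS hU] := main_terms_bounds theta n t0 vl S1 hB.
have e0 : 0 < stein_scale :> R by rewrite /stein_scale; lra.
have e8 : 12 * stein_scale ^+ 2 <= 1 :> R by rewrite /stein_scale; lra.
have e3 : 36 * stein_scale ^+ 3 = stein_scale ^+ 2 / 600 :> R.
  by rewrite /stein_scale; field.
have e2 : 0 < stein_scale ^+ 2 :> R by rewrite exprn_gt0.
have hs := stein_bernE _ n _ p01 S0 e0 e8.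
have hm := ewens_smoothing _ _ _ _ _ _ stein_scale r n0 t0 law S0 e0 _ hr.
have hsm h8 := le_trans hs (lerD (hm h8) (lexx _)).
have g3 : 0 <= gamma3 n theta.
  rewrite gamma3E// divr_ge0 ?sqr_ge0// addr_ge0// /mainC divr_ge0//.
  by rewrite mulr_ge0 ?(ltW t0)// exprn_ge0// subr_ge0; case/andP: (p01 n).
apply: (absorb_error e2 r0 g3 erefl stein_const_ge36 _ hS (le_trans hg hU)) => //.
by rewrite -e3; apply: hsm; lra.
Qed.

Theorem theorem2p4 (R : realType) :
  exists D : R, 0 < D /\
  forall (theta : nat -> R)
    (theta_gt0 : forall n, (1 <= n)%N -> 0 < theta n)
    (theta_nondecreasing :
      forall m n, (1 <= m)%N -> (m <= n)%N -> theta m <= theta n)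
    (d : nat -> measure_display) (T : forall n, measurableType (d n))
    (P : forall n, probability (T n) R) (K : forall n, {RV (P n) >-> R})
    (K_law : forall n, (1 <= n)%N -> has_K_law n (theta n) (K n)),
  (forall n1 : nat, (1 <= n1)%N ->
    (forall n, (n1 <= n)%N ->
      [/\ 0 < var_lower n (theta n),
          (1 <= variance (P n) (K n))%E
        & 0 < third_lower n (theta n)]) ->
    forall n, (n1 <= n)%N ->
      ((gamma2 n (theta n) / D - gamma3 n (theta n))%R%:E
        <= sup_norm (fun x => (Fdist (K n) x - Phi x)%R))%E)
  /\
  (forall n2 : nat, (1 <= n2)%N ->
    (forall n, (n2 <= n)%N ->
      [/\ 0 < var_lower n (theta n),
          (1 <= variance (P n) (K n))%E
        & third_upper n (theta n) < 0]) ->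
    forall n, (n2 <= n)%N ->
      ((gamma4 n (theta n) / D - gamma3 n (theta n))%R%:E
        <= sup_norm (fun x => (Fdist (K n) x - Phi x)%R))%E).
Proof.
exists stein_const; split; first by have := @stein_const_ge36 R; lra.
move=> theta t0 _ d T P K law; split=> n1 n1_gt0 h n n1n.
  have n0 : (0 < n)%N by exact: leq_trans n1n.
  have [vl v1 tl] := h n n1n.
  have [hB hg] := gamma2_le _ _ (t0 n n0) tl.
  exact: sup_norm_lower n0 (t0 n n0) (law n n0) vl v1 hB hg.
have n0 : (0 < n)%N by exact: leq_trans n1n.
have [vl v1 tl] := h n n1n.
have [hB hg] := gamma4_le _ _ (t0 n n0) tl.
exact: sup_norm_lower n0 (t0 n n0) (law n n0) vl v1 hB hg.
Qed.
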